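(* Let $p,q$ be positive integers. The minimal $H$-representation of the polytope of ultramodular discrete copulas $\mathrm{UDC}_{p,q}$ consists of the $(p-2)(q-2)+2(p-1)(q-1)$ inequalities \begin{enumerate} \item[(d1)] $x_{11}\ge 0$ and $x_{p-1,q-1}\ge \frac{(p-1)(q-1)-1}{pq}$; \item[(d2)] $x_{ij}+x_{i+1,j+1}-x_{i,j+1}-x_{i+1,j}\ge 0$ for all $i\in\{1,\dots,p-2\}$, $j\in\{1,\dots,q-2\}$ with $(i,j)\notin\{(1,1),(p-2,q-2)\}$; \item[(d3a)] $x_{ij}+x_{i,j+2}-2x_{i,j+1}\ge 0$ for all $i\in\{1,\dots,p-1\}$, $j\in\{0,\dots,q-2\}$; \item[(d3b)] $x_{ij}+x_{i+2,j}-2x_{i+1,j}\ge 0$ for all $j\in\{1,\dots,q-1\}$, $i\in\{0,\dots,p-2\}$. \end{enumerate}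
   Context: Matrices in $\mathbb{R}^{(p+1)\times(q+1)}$ have rows indexed by $0,\dots,p$ and columns indexed by $0,\dots,q$. The polytope of discrete copulas $\mathrm{DC}_{p,q}$ is the set of all $[c_{ij}]\in\mathbb{R}^{(p+1)\times(q+1)}$ such that (c1) $c_{0j}=0$, $c_{pj}=\frac{j}{q}$, $c_{i0}=0$, $c_{iq}=\frac{i}{p}$ for all $0\le i\le p$, $0\le j\le q$; (c2) $c_{ij}+c_{i-1,j-1}-c_{i,j-1}-c_{i-1,j}\ge 0$ for all $1\le i\le p$, $1\le j\le q$. The polytope of ultramodular discrete copulas $\mathrm{UDC}_{p,q}$ is the set of all $[c_{ij}]\in\mathrm{DC}_{p,q}$ that in addition satisfy $2c_{ij}\le c_{i-1,j}+c_{i+1,j}$ and $2c_{ij}\le c_{i,j-1}+c_{i,j+1}$ for all $1\le i\le p-1$, $1\le j\le q-1$. An $H$-representation of a polytope is a collection of affine inequalities defining it; the minimal $H$-representation is the unique irredundant one, and its size is the number of facets. Here the polytope is regarded inside the affine space cut out by the boundary equalities (c1): a matrix $[x_{ij}]$ satisfying (c1) lies in the polytope if and only if it satisfies all the inequalities of the $H$-representation, and irredundant means that for each inequality there is a matrix satisfying (c1) and all the other inequalities but violating that one.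
   Formalization: The list is shown to be an H-representation for all positive p, q; minimality is claimed only for p, q ≥ 3 (for p or q ≤ 2 some listed inequalities are redundant), and the count only for p, q ≥ 3 with (p,q) ≠ (3,3), where the list has 10 inequalities, not 9. *)

(* Defs.v *)
From mathcomp Require Import all_boot all_order all_algebra.

Set Implicit Arguments.
Unset Strict Implicit.
Unset Printing Implicit Defensive.

Import Order.TTheory GRing.Theory Num.Theory.
Local Open Scope ring_scope.

(* R is any ordered field, in particular the real numbers. *)

(* Entries are addressed by natural numbers.  [inord] sends an out-of-range
   index to 0; for positive p and q every index used below is in range. *)
Definition entry (R : realFieldType) (p q : nat)
    (x : 'M[R]_(p.+1, q.+1)) (i j : nat) : R :=
  x (inord i) (inord j).

Definition copula_boundary (R : realFieldType) (p q : nat)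
    (x : 'M[R]_(p.+1, q.+1)) : Prop :=
  (forall j : nat, (j <= q)%N ->
     entry x 0 j = 0 /\ entry x p j = j%:R / q%:R) /\
  (forall i : nat, (i <= p)%N ->
     entry x i 0 = 0 /\ entry x i q = i%:R / p%:R).

Definition discrete_copula (R : realFieldType) (p q : nat)
    (x : 'M[R]_(p.+1, q.+1)) : Prop :=
  copula_boundary x /\
  (forall i j : nat, (1 <= i <= p)%N -> (1 <= j <= q)%N ->
     0 <= entry x i j + entry x i.-1 j.-1 - entry x i j.-1 - entry x i.-1 j).

Definition ultramodular_discrete_copula (R : realFieldType) (p q : nat)
    (x : 'M[R]_(p.+1, q.+1)) : Prop :=
  discrete_copula x /\
  (forall i j : nat, (1 <= i <= p.-1)%N -> (1 <= j <= q.-1)%N ->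
     2 * entry x i j <= entry x i.-1 j + entry x i.+1 j /\
     2 * entry x i j <= entry x i j.-1 + entry x i j.+1).

(* The pair (A, b) stands for the inequality \sum_(i, j) A i j * x i j >= b. *)
Definition satisfies (R : realFieldType) (p q : nat)
    (x : 'M[R]_(p.+1, q.+1)) (a : 'M[R]_(p.+1, q.+1) * R) : bool :=
  a.2 <= \sum_i \sum_j a.1 i j * x i j.

(* Representations of the polytope P relative to the affine space V. *)
Definition H_representation (R : realFieldType) (p q : nat)
    (V P : 'M[R]_(p.+1, q.+1) -> Prop)
    (s : seq ('M[R]_(p.+1, q.+1) * R)) : Prop :=
  forall x, V x -> (P x <-> all (satisfies x) s).

(* With [uniq], the list s is a set of inequalities and [size s] counts it. *)
Definition irredundant (R : realFieldType) (p q : nat)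
    (V : 'M[R]_(p.+1, q.+1) -> Prop)
    (s : seq ('M[R]_(p.+1, q.+1) * R)) : Prop :=
  uniq s /\
  forall a, a \in s ->
    exists x, [/\ V x,
                  forall b, b \in s -> b != a -> satisfies x b
                & ~~ satisfies x a].

Definition minimal_H_representation (R : realFieldType) (p q : nat)
    (V P : 'M[R]_(p.+1, q.+1) -> Prop)
    (s : seq ('M[R]_(p.+1, q.+1) * R)) : Prop :=
  H_representation V P s /\ irredundant V s.

Section UDCInequalities.
Variables (R : realFieldType) (p q : nat).

(* The coefficient matrix of the linear form x |-> x_(i, j). *)
Definition coord_form (i j : nat) : 'M[R]_(p.+1, q.+1) :=
  delta_mx (inord i) (inord j).

Definition corner_ineqs : seq ('M[R]_(p.+1, q.+1) * R) :=
  [:: (coord_form 1 1, 0);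
      (coord_form p.-1 q.-1,
       ((p%:R - 1) * (q%:R - 1) - 1) / (p%:R * q%:R))].

Definition rectangle_ineqs : seq ('M[R]_(p.+1, q.+1) * R) :=
  [seq (coord_form ij.1 ij.2 + coord_form ij.1.+1 ij.2.+1
        - coord_form ij.1 ij.2.+1 - coord_form ij.1.+1 ij.2, 0)
  | ij <- [seq (i, j) | i <- iota 1 (p - 2), j <- iota 1 (q - 2)]
  & ij \notin [:: (1, 1); (p - 2, q - 2)]%N].

Definition row_convexity_ineqs : seq ('M[R]_(p.+1, q.+1) * R) :=
  [seq (coord_form i j + coord_form i j.+2 - 2 *: coord_form i j.+1, 0)
  | i <- iota 1 (p - 1), j <- iota 0 (q - 1)].

Definition column_convexity_ineqs : seq ('M[R]_(p.+1, q.+1) * R) :=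
  [seq (coord_form i j + coord_form i.+2 j - 2 *: coord_form i.+1 j, 0)
  | j <- iota 1 (q - 1), i <- iota 0 (p - 1)].

Definition udc_ineqs : seq ('M[R]_(p.+1, q.+1) * R) :=
  corner_ineqs ++ rectangle_ineqs ++ row_convexity_ineqs ++ column_convexity_ineqs.

End UDCInequalities.

Arguments udc_ineqs : clear implicits.

(* Main.v *)
Require Import Defs.
From HB Require Import structures.
From mathcomp Require Import all_boot all_order all_algebra zify ring lra.

Import Order.TTheory GRing.Theory Num.Theory.

(* Sufficiency: convexity of row 1 and x_11 >= 0 make the volumes of the cells
   in the first row increasing and nonnegative, and likewise along the other
   sides; the two missing inner cells follow from x_12, x_21 <= x_22 / 2 and
   its mirror image.

   Irredundancy: write x_ij = (ij - F_ij) / (pq) with F zero on the boundary.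
   Then the inequalities say that F is biconcave, that all its mixed
   differences are at most 1 and that F_11, F_(p-1,q-1) <= 1.  One looks for F
   violating exactly one of these.
   - Corners: a multiple of a product of tents peaked next to that corner.
   - Row convexity at (i, j): a small multiple of tent_i * tent_l - delta_ij
     with l <> j, since tent_l is linear at j and tent_i strictly concave at i.
   - A cell: F piecewise bilinear, determined by its values at the four vertices
     of that cell.  All conditions on F then reduce to finitely many linear
     inequalities in these four values. *)

(** * Integer vertex values for the cell inequalities *)

(* A, x, y, D are, up to a common factor, the values of F at the vertices (a, b),
   (a, b+1), (a+1, b), (a+1, b+1), in a grid with p = a + 1 + c and
   q = b + 1 + d.  The first eight inequalities express concavity along the
   four grid lines through the vertices; the last two say that the mixed
   difference on the cell exceeds those on the corner blocks. *)
Definition cell_values (a b c d A D x y : nat) :=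
  [/\ b * x <= b.+1 * A, d * A <= d.+1 * x, b * D <= b.+1 * y & d * y <= d.+1 * D] /\
  [/\ a * y <= a.+1 * A, c * A <= c.+1 * y, a * D <= a.+1 * x & c * x <= c.+1 * D] /\
  [/\ 0 < A, 0 < D, A + a * b * (x + y) < a * b * (A + D)
    & D + c * d * (x + y) < c * d * (A + D)].

(** Transposing the grid swaps [a] with [b], [c] with [d], and the vertices carrying [x] and [y]. *)
Lemma cell_values_tr a b c d A D x y :
  cell_values a b c d A D x y -> cell_values b a d c A D y x.
Proof.
case=> [[? ? ? ?] [[? ? ? ?] [? ? ? ?]]].
by rewrite /cell_values (mulnC b a) (mulnC d c) (addnC y x).
Qed.

(** The half-turn of the grid swaps opposite vertices of the cell. *)
Lemma cell_values_rot a b c d A D x y :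
  cell_values a b c d A D x y -> cell_values c d a b D A y x.
Proof.
case=> [[? ? ? ?] [[? ? ? ?] [? ? ? ?]]].
by rewrite /cell_values (addnC D A) (addnC y x).
Qed.

(** Relative to [A], the values [x] and [y] are the smallest that concavity allows, and [D] is then
    the largest with [b * D <= b.+1 * y]. The other upper bound, [a * D <= a.+1 * x], is exactly the
    hypothesis comparing the two long products. The mixed difference is [b * c.+1 + c * d.+1]; it
    beats the lower corner block because [d < a * b] and the upper one because [1 < c * d]. *)
Lemma cell_values_main a b c d : 0 < a -> 0 < b -> 1 < c * d ->
  a * d.+1 * b.+1 * c <= b * c.+1 * a.+1 * d -> d < a * b ->
  cell_values a b c d (b * c.+1 * d.+1) (b.+1 * c * d.+1) (b * d * c.+1) (b * c * d.+1).
Proof.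
move=> a0 b0 cd le_ad lt_d.
have [c0 d0] : 0 < c /\ 0 < d by case: c d cd {le_ad lt_d} => [|c] [|d]; rewrite ?muln0.
by split; [split; nia | split; split; nia].
Qed.

Lemma cell_values_exist (a b c d : nat) :
  (0 < a -> 0 < b -> 0 < c -> 0 < d -> 1 < a * b -> 1 < c * d ->
  exists A D x y, cell_values a b c d A D x y)%N.
Proof.
move=> a0 b0 c0 d0 ab cd.
(* Transposition exchanges the two sides of this inequality. *)
wlog le_ad : a b c d a0 b0 c0 d0 ab cd / (a * d.+1 * b.+1 * c <= b * c.+1 * a.+1 * d)%N.
  move=> th; have [|/ltnW le_da] := leqP (a * d.+1 * b.+1 * c) (b * c.+1 * a.+1 * d).
    exact: th.
  have [A [D [x [y /cell_values_tr]]]] : exists A D x y, cell_values b a d c A D x y.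
    by apply: th => //; rewrite mulnC.
  by exists A, D, y, x.
have [lt_d|le_d] := ltnP d (a * b).
  by do 4!eexists; apply: cell_values_main.
have [lt_b|le_b] := ltnP b (c * d).
  (* The half-turn preserves [le_ad] and turns [d < a * b] into [b < c * d]. *)
  do 4!eexists; apply: cell_values_rot; apply: cell_values_main => //; nia.
(* Now a b <= d and c d <= b, which forces a = c = 1. *)
have [a1 c1 bd] : [/\ a = 1, c = 1 & b = d]%N by split; nia.
(* The mixed difference of these values is 2, against [(d + 1) / d] on both corner blocks, and
   [d > 1] because [a * b > 1]. *)
exists d.+1, d.+1, d, d; rewrite a1 c1 bd; split; [split; nia|split; split; nia].
Qed.

Local Open Scope ring_scope.

(** * Labels for the inequalities *)

(** Membership, uniqueness and counting are settled on labels, away from matrices. Distinct labels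
    need not give distinct inequalities: the two corners coincide when [p = q = 2]. *)
Variant facet : Type :=
  | LowerCorner
  | UpperCorner
  | Rectangle of nat & nat
  | RowConvexity of nat & nat
  | ColConvexity of nat & nat.

Definition facet_code (k : facet) : nat * (nat * nat) :=
  match k with
  | LowerCorner => (0, (0, 0))
  | UpperCorner => (1, (0, 0))
  | Rectangle i j => (2, (i, j))
  | RowConvexity i j => (3, (i, j))
  | ColConvexity i j => (4, (i, j))
  end%N.

Definition facet_decode (c : nat * (nat * nat)) : facet :=
  let: (t, (i, j)) := c in
  match t with
  | 0 => LowerCorner
  | 1 => UpperCorner
  | 2 => Rectangle i j
  | 3 => RowConvexity i j
  | _ => ColConvexity i j
  end%N.

Lemma facet_codeK : cancel facet_code facet_decode. Proof. by case. Qed.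

HB.instance Definition _ := Equality.copy facet (can_type facet_codeK).

Definition facets (p q : nat) : seq facet :=
  [:: LowerCorner; UpperCorner]
  ++ [seq Rectangle ij.1 ij.2
     | ij <- [seq (i, j) | i <- iota 1 (p - 2), j <- iota 1 (q - 2)]
     & ij \notin [:: (1, 1); (p - 2, q - 2)]%N]
  ++ [seq RowConvexity i j | i <- iota 1 (p - 1), j <- iota 0 (q - 1)]
  ++ [seq ColConvexity i j | j <- iota 1 (q - 1), i <- iota 0 (p - 1)].

Definition is_facet (p q : nat) (k : facet) : bool :=
  match k with
  | LowerCorner | UpperCorner => true
  | Rectangle i j =>
      [&& 0 < i, i.+1 < p, 0 < j, j.+1 < q
        & (i, j) \notin [:: (1, 1); (p - 2, q - 2)]]
  | RowConvexity i j => [&& 0 < i, i < p & j.+1 < q]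
  | ColConvexity i j => [&& 0 < j, j < q & i.+1 < p]
  end%N.

Lemma mem_facets (p q : nat) (k : facet) : (k \in facets p q) = is_facet p q k.
Proof.
rewrite /facets !mem_cat; apply/idP/idP.
- case/or4P => [|/mapP[[i j]]|/allpairsP[[i j] [/= ]]|/allpairsP[[j i] [/= ]]].
  + by rewrite !inE => /orP[] /eqP->.
  + rewrite mem_filter => /andP[nij /allpairsP[[i' j'] [/= + + [ei ej]]]] ->.
    by rewrite -ei -ej /is_facet !mem_iota nij; lia.
  + by rewrite !mem_iota => ? ? -> /=; lia.
  + by rewrite !mem_iota => ? ? -> /=; lia.
- case: k => [||i j|i j|i j] //=.
  + case/and5P => ? ? ? ? nij; apply/or3P; apply: Or31; apply/mapP; exists (i, j) => //.
    by rewrite mem_filter nij; apply/allpairsP; exists (i, j); rewrite !mem_iota; split=> //=; lia.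
  + case/and3P=> ? ? ?; apply/or3P; apply: Or32; apply/allpairsP; exists (i, j).
    by rewrite !mem_iota; split=> //=; lia.
  + case/and3P=> ? ? ?; apply/or3P; apply: Or33; apply/allpairsP; exists (j, i).
    by rewrite !mem_iota; split=> //=; lia.
Qed.

Lemma uniq_facets (p q : nat) : uniq (facets p q).
Proof.
have rectI : injective (fun ij : nat * nat => Rectangle ij.1 ij.2).
  by move=> [i j] [i' j'] /= [-> ->].
rewrite /facets 3!cat_uniq map_inj_uniq // filter_uniq ?allpairs_uniq ?iota_uniq //=;
  try by move=> [i j] [i' j'] _ _ /= [-> ->].
rewrite !andbT; apply/and3P; split; apply/hasPn=> k; rewrite ?mem_cat.
- case/or3P => [/mapP[? _ ->]|/allpairsP[? [_ _ ->]]|/allpairsP[? [_ _ ->]]] //.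
- by case/orP => /allpairsP[? [_ _ ->]]; apply/negP=> /mapP[].
- by case/allpairsP => ? [_ _ ->]; apply/negP=> /allpairsP[? []].
Qed.

Definition facet_ineq (R : realFieldType) (p q : nat) (k : facet) :
    'M[R]_(p.+1, q.+1) * R :=
  let e := coord_form R p q in
  match k with
  | LowerCorner => (e 1%N 1%N, 0)
  | UpperCorner =>
      (e p.-1 q.-1, ((p%:R - 1) * (q%:R - 1) - 1) / (p%:R * q%:R))
  | Rectangle i j => (e i j + e i.+1 j.+1 - e i j.+1 - e i.+1 j, 0)
  | RowConvexity i j => (e i j + e i j.+2 - 2 *: e i j.+1, 0)
  | ColConvexity i j => (e i j + e i.+2 j - 2 *: e i.+1 j, 0)
  end.

Lemma udc_ineqsE (R : realFieldType) (p q : nat) :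
  udc_ineqs R p q = map (facet_ineq R p q) (facets p q).
Proof.
rewrite /facets !map_cat !map_allpairs -map_comp.
by [].
Qed.

Lemma form_coord (R : realFieldType) (p q : nat) (x : 'M[R]_(p.+1, q.+1)) i j :
  \sum_s \sum_t coord_form R p q i j s t * x s t = entry x i j.
Proof.
rewrite (bigD1 (inord i)) //= (bigD1 (inord j)) //= mxE !eqxx mul1r.
rewrite !big1 ?addr0 // => [s /negPf si|t /negPf tj].
  by apply: big1 => t _; rewrite mxE si mul0r.
by rewrite mxE tj andbF mul0r.
Qed.

Definition holds (R : realFieldType) (p q : nat) (c : nat -> nat -> R) (k : facet) :=
  match k with
  | LowerCorner => 0 <= c 1%N 1%N
  | UpperCorner =>
      ((p%:R - 1) * (q%:R - 1) - 1) / (p%:R * q%:R) <= c p.-1 q.-1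
  | Rectangle i j => c i j.+1 + c i.+1 j <= c i j + c i.+1 j.+1
  | RowConvexity i j => 2 * c i j.+1 <= c i j + c i j.+2
  | ColConvexity i j => 2 * c i.+1 j <= c i j + c i.+2 j
  end.

Lemma satisfies_facet_ineq (R : realFieldType) (p q : nat)
    (x : 'M[R]_(p.+1, q.+1)) (k : facet) :
  satisfies x (facet_ineq R p q k) = holds R p q (entry x) k.
Proof.
pose f (A : 'M[R]_(p.+1, q.+1)) := \sum_s \sum_t A s t * x s t.
have fD A B : f (A + B) = f A + f B.
  rewrite -big_split; apply: eq_bigr => s _; rewrite -big_split.
  by apply: eq_bigr => t _; rewrite mxE mulrDl.
have fZ a A : f (a *: A) = a * f A.
  rewrite mulr_sumr; apply: eq_bigr => s _; rewrite mulr_sumr.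
  by apply: eq_bigr => t _; rewrite mxE mulrA.
have fN A : f (- A) = - f A by rewrite -scaleN1r fZ mulN1r.
rewrite /satisfies -/(f _); case: k => [||i j|i j|i j];
  rewrite /= ?fD ?fN ?fZ /f !form_coord // -subr_ge0 -[RHS]subr_ge0;
  congr (_ <= _); ring.
Qed.

(** * Sufficiency of the listed inequalities *)

Lemma increasing_differences (R : realFieldType) (n : nat) (g : nat -> R) :
  (forall j, (j.+1 < n)%N -> 2 * g j.+1 <= g j + g j.+2) ->
  forall i j, (i <= j < n)%N -> g i.+1 - g i <= g j.+1 - g j.
Proof.
move=> cvx i j /andP[]; elim: j => [|j IHj]; first by rewrite leqn0 => /eqP->.
rewrite leq_eqVlt => /predU1P[-> //|lt_ij] lt_jn.
by have := IHj lt_ij (ltnW lt_jn); have := cvx j lt_jn; lra.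
Qed.

Lemma supermodular_of_facets (R : realFieldType) (p q : nat) (c : nat -> nat -> R) :
  (0 < p)%N -> (0 < q)%N ->
  (forall j, (j <= q)%N -> c 0%N j = 0 /\ c p j = j%:R / q%:R) ->
  (forall i, (i <= p)%N -> c i 0%N = 0 /\ c i q = i%:R / p%:R) ->
  (forall k, is_facet p q k -> holds R p q c k) ->
  forall i j, (i < p)%N -> (j < q)%N ->
    c i j.+1 + c i.+1 j <= c i j + c i.+1 j.+1.
Proof.
move=> p0 q0 bc br hold i j ip jq.
have pn0 : p%:R != 0 :> R by rewrite pnatr_eq0 -lt0n.
have qn0 : q%:R != 0 :> R by rewrite pnatr_eq0 -lt0n.
have step n k : n%:R != 0 :> R -> k.+1%:R / n%:R - k%:R / n%:R = n%:R^-1 :> R.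
  by move=> n0; rewrite -natr1; field.
have last n : (0 < n)%N -> n.-1%:R / n%:R = 1 - n%:R^-1 :> R.
  by move=> n0; rewrite -subn1 natrB // mulrBl divff ?mul1r // pnatr_eq0 -lt0n.
have row k l1 l2 : (0 < k < p)%N -> (l1 <= l2 < q)%N ->
    c k l1.+1 - c k l1 <= c k l2.+1 - c k l2.
  move=> /andP[k0 kp]; apply: (increasing_differences _ q (c k)) => l lq.
  by apply: (hold (RowConvexity k l)); rewrite /= k0 kp.
have col l k1 k2 : (0 < l < q)%N -> (k1 <= k2 < p)%N ->
    c k1.+1 l - c k1 l <= c k2.+1 l - c k2 l.
  move=> /andP[l0 lq]; apply: (increasing_differences _ p (c^~ l)) => k kp.
  by apply: (hold (ColConvexity k l)); rewrite /= l0 lq.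
have c11 : 0 <= c 1%N 1%N := hold LowerCorner isT.
(* The upper corner inequality says that the cell at the corner [(p, q)] has nonnegative volume. *)
have cpq : 1 - p%:R^-1 - q%:R^-1 <= c p.-1 q.-1.
  have /= := hold UpperCorner isT; congr (_ <= _); field; exact/andP.
have c0 l : (l <= q)%N -> c 0%N l = 0 by case/bc.
have cp l : (l <= q)%N -> c p l = l%:R / q%:R by case/bc.
have r0 k : (k <= p)%N -> c k 0%N = 0 by case/br.
have rq k : (k <= p)%N -> c k q = k%:R / p%:R by case/br.
have [ec0 ec1] : c 0%N j = 0 /\ c 0%N j.+1 = 0 by rewrite !c0 // ltnW.
have [er0 er1] : c i 0%N = 0 /\ c i.+1 0%N = 0 by rewrite !r0 // ltnW.
have sj := step q j qn0; have si := step p i pn0.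
have lp := last p p0; have lq := last q q0.
(* For [p = 1] every entry lies on the boundary and each cell has volume [1 / q]; the case [q = 1]
   is symmetric. *)
have [p1|p_gt1] := leqP p 1.
  have [ei ep] : i = 0%N /\ i.+1 = p by lia.
  rewrite ep ei ec0 ec1 !cp // ?(ltnW jq) //.
  have : 0 <= q%:R^-1 :> R; [by rewrite invr_ge0 ler0n | lra].
have [q1|q_gt1] := leqP q 1.
  have [ej eq] : j = 0%N /\ j.+1 = q by lia.
  rewrite eq ej er0 er1 !rq // ?(ltnW ip) //.
  have : 0 <= p%:R^-1 :> R; [by rewrite invr_ge0 ler0n | lra].
have [i0|i_gt0] := posnP i.
  have := row 1%N 0%N j ltac:(lia) ltac:(lia).
  by rewrite i0 ec0 ec1 (r0 1%N); [lra | lia].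
have [j0|j_gt0] := posnP j.
  have := col 1%N 0%N i ltac:(lia) ltac:(lia).
  by rewrite j0 er0 er1 (c0 1%N); [lra | lia].
(* Volumes in the last row of cells are [1 / q] minus the increments of row [p - 1]. The last
   increment is the largest, and [cpq] bounds it by [1 / q]. *)
have [ipE|ip1] := eqVneq i.+1 p.
  have ei : i = p.-1 by lia.
  have := row i j q.-1 ltac:(lia) ltac:(lia).
  rewrite ipE prednK // !cp // ?(ltnW jq) // rq ?(ltnW ip) // ei; lra.
have [jqE|jq1] := eqVneq j.+1 q.
  have ej : j = q.-1 by lia.
  have := col j i p.-1 ltac:(lia) ltac:(lia).
  rewrite jqE prednK // !rq // ?(ltnW ip) // cp ?(ltnW jq) // ej; lra.
have [cell|] := boolP ((i, j) \notin [:: (1, 1); (p - 2, q - 2)]%N).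
  by apply: (hold (Rectangle i j)); rewrite /= cell; lia.
rewrite negbK !inE => /orP[] /eqP[-> ->].
  have := row 2%N 0%N 1%N ltac:(lia) ltac:(lia).
  have := col 2%N 0%N 1%N ltac:(lia) ltac:(lia).
  by rewrite (c0 2%N) ?(r0 2%N); [lra | lia ..].
(* Half the sum of these two convexities bounds the antidiagonal sum of the cell by
   [x_(p-2,q-2) + 1 - 1/p - 1/q], and [cpq] concludes. *)
have := row (p - 2)%N (q - 2)%N q.-1 ltac:(lia) ltac:(lia).
have := col (q - 2)%N (p - 2)%N p.-1 ltac:(lia) ltac:(lia).
rewrite !prednK // rq ?cp ?leq_subr //.
have [-> ->] : (p - 2).+1 = p.-1 /\ (q - 2).+1 = q.-1 by lia.
have frac n : (1 < n)%N -> (n - 2)%:R / n%:R = 1 - 2 * n%:R^-1 :> R.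
  by move=> n1; rewrite natrB // mulrBl divff // pnatr_eq0; lia.
rewrite !frac //; lra.
Qed.

Lemma H_representation_udc (R : realFieldType) (p q : nat) :
  (0 < p)%N -> (0 < q)%N ->
  H_representation (@copula_boundary R p q)
    (@ultramodular_discrete_copula R p q) (udc_ineqs R p q).
Proof.
move=> p0 q0 x Vx; have [bc br] := Vx.
have allE : all (satisfies x) (udc_ineqs R p q) <->
    forall k, is_facet p q k -> holds R p q (entry x) k.
  rewrite udc_ineqsE all_map; split=> [/allP sat k|hold].
    by rewrite -mem_facets => /sat; rewrite /= satisfies_facet_ineq.
  by apply/allP=> k; rewrite mem_facets /= satisfies_facet_ineq => /hold.
rewrite allE; split=> [[[_ smod] umod] k|hold].
- case: k => [||i j|i j|i j] /=.
  + move=> _; have := smod 1%N 1%N p0 q0; rewrite /=.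
    have [[-> _] [-> _]] := (bc 0%N (leq0n q), bc 1%N q0).
    by have [-> _] := br 1%N p0; lra.
  + move=> _; have := smod p q; rewrite !leqnn p0 q0 => /(_ isT isT).
    have [[_ ->] [_ ->]] := (bc q (leqnn q), bc q.-1 (leq_pred q)).
    have [_ ->] := br p.-1 (leq_pred p).
    have pn0 : p%:R != 0 :> R by rewrite pnatr_eq0 -lt0n.
    have qn0 : q%:R != 0 :> R by rewrite pnatr_eq0 -lt0n.
    rewrite -!subn1 !natrB // -subr_ge0 => le; rewrite -subr_ge0.
    by move: le; congr (_ <= _); field; exact/andP.
  + case/and5P=> ? ? ? ? _; have := smod i.+1 j.+1 ltac:(lia) ltac:(lia).
    by rewrite /=; lra.
  + case/and3P=> ? ? ?; have [_] := umod i j.+1 ltac:(lia) ltac:(lia).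
    by [].
  + case/and3P=> ? ? ?; have [+ _] := umod i.+1 j ltac:(lia) ltac:(lia).
    by [].
- have smod := supermodular_of_facets _ p q _ p0 q0 bc br hold.
  split; first split=> // -[|i] [|j] //= ip jq.
    by have := smod i j ip jq; lra.
  move=> [|i] [|j] //= ip jq; split.
    by apply: (hold (ColConvexity i j.+1)); rewrite /=; lia.
  by apply: (hold (RowConvexity i.+1 j)); rewrite /=; lia.
Qed.

(** * Size of the list *)

(** The two corner inequalities make up for the two omitted cells. For [p = q = 3] the omitted cells
    are one and the same, and the list is longer by one. *)
Lemma size_udc_ineqs (R : realFieldType) (p q : nat) :
  (3 <= p)%N -> (3 <= q)%N -> (p, q) <> (3, 3)%N ->
  size (udc_ineqs R p q) = ((p - 2) * (q - 2) + 2 * ((p - 1) * (q - 1)))%N.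
Proof.
move=> p3 q3 /eqP; rewrite xpair_eqE => pq.
rewrite udc_ineqsE size_map /facets !size_cat size_map !size_allpairs !size_iota /=.
set cells := [seq (i, j) | i <- _, j <- _]; set s := [:: _; _].
have cells_size : size cells = ((p - 2) * (q - 2))%N by rewrite size_allpairs !size_iota.
have cells_uniq : uniq cells.
  by apply: allpairs_uniq; rewrite ?iota_uniq // => -[? ?] [? ?].
have /perm_size : perm_eq (s ++ [seq ij <- cells | ij \notin s]) cells.
  apply: uniq_perm => // [|ij].
    rewrite cat_uniq filter_uniq // andbT; apply/andP; split.
      by rewrite /= inE xpair_eqE; lia.
    by apply/hasPn => ij; rewrite mem_filter => /andP[].
  rewrite mem_cat mem_filter; case: (boolP (ij \in s)) => //= ij_s; apply/esym/allpairsP.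
  exists ij; move: ij_s; rewrite !inE !mem_iota => /orP[] /eqP-> /=; split=> //; lia.
by rewrite size_cat cells_size /=; lia.
Qed.

(** * Irredundancy reduced to functions vanishing on the boundary *)

(* What [holds] becomes for x_ij = (ij - F i j) / (pq), see [holds_copula_of]. *)
Definition within (R : realFieldType) (p q : nat) (F : nat -> nat -> R) (k : facet) :=
  match k with
  | LowerCorner => F 1%N 1%N <= 1
  | UpperCorner => F p.-1 q.-1 <= 1
  | Rectangle i j => F i j + F i.+1 j.+1 - F i j.+1 - F i.+1 j <= 1
  | RowConvexity i j => F i j + F i j.+2 <= 2 * F i j.+1
  | ColConvexity i j => F i j + F i.+2 j <= 2 * F i.+1 j
  end.

Definition isolates (R : realFieldType) (p q : nat) (F : nat -> nat -> R) (k : facet) :=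
  [/\ forall j, F 0%N j = 0 /\ F p j = 0,
      forall i, F i 0%N = 0 /\ F i q = 0
    & forall l, is_facet p q l -> within R p q F l = (l != k)].

(** A perturbation of the product copula [i j / (p q)], at which all convexity inequalities are
    tight and all cells have volume [1 / (p q)]. *)
Definition copula_of (R : realFieldType) (p q : nat) (F : nat -> nat -> R) :
    'M[R]_(p.+1, q.+1) :=
  \matrix_(i, j) (((i * j)%:R - F i j) / (p * q)%:R).

Lemma entry_copula_of (R : realFieldType) (p q : nat) (F : nat -> nat -> R) i j :
  (i <= p)%N -> (j <= q)%N ->
  entry (copula_of R p q F) i j = ((i * j)%:R - F i j) / (p * q)%:R.
Proof. by move=> ip jq; rewrite /entry mxE !inordK. Qed.

(** The product [i j] is affine in each variable, so it cancels in the convexity inequalities; its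
    mixed differences are 1, which gives the bound 1 for cells. At the corners the bound 1 is the
    gap between [i j] and the prescribed constant. *)
Lemma holds_copula_of (R : realFieldType) (p q : nat) (F : nat -> nat -> R) k :
  (1 < p)%N -> (1 < q)%N -> is_facet p q k ->
  holds R p q (entry (copula_of R p q F)) k = within R p q F k.
Proof.
move=> p1 q1.
have pos : 0 < (p * q)%:R^-1 :> R by rewrite invr_gt0 ltr0n muln_gt0; lia.
have scaleE (u v t w : R) : v - u = (w - t) / (p * q)%:R -> (u <= v) = (t <= w).
  by move=> e; rewrite -subr_ge0 e pmulr_lge0 // subr_ge0.
case: k => [||i j|i j|i j] /=.
- move=> _; rewrite entry_copula_of //; try lia.
  by apply: scaleE; rewrite subr0.
- move=> _; rewrite entry_copula_of ?leq_pred //; apply: scaleE.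
  by rewrite -!subn1 !natrM !natrB ?(ltnW p1) ?(ltnW q1) // -mulrBl; congr (_ / _); ring.
- case/and5P=> *; rewrite !entry_copula_of; try lia.
  by apply: scaleE; rewrite !natrM -!natr1; ring.
- case/and3P=> *; rewrite !entry_copula_of; try lia.
  by apply: scaleE; rewrite !natrM -!natr1; ring.
- case/and3P=> *; rewrite !entry_copula_of; try lia.
  by apply: scaleE; rewrite !natrM -!natr1; ring.
Qed.

Lemma irredundant_of_isolates (R : realFieldType) (p q : nat) :
  (1 < p)%N -> (1 < q)%N ->
  (forall k, is_facet p q k -> exists F, isolates R p q F k) ->
  irredundant (@copula_boundary R p q) (udc_ineqs R p q).
Proof.
move=> p1 q1 iso.
have pn0 : p%:R != 0 :> R by rewrite pnatr_eq0; lia.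
have qn0 : q%:R != 0 :> R by rewrite pnatr_eq0; lia.
have witness k : is_facet p q k -> exists x, copula_boundary x /\
    forall l, is_facet p q l -> satisfies x (facet_ineq R p q l) = (l != k).
  move=> /iso[F [F_top F_side F_iso]]; exists (copula_of R p q F); split.
    split=> s s_le; split; rewrite entry_copula_of //.
    - by rewrite (F_top s).1 mul0n subrr mul0r.
    - by rewrite (F_top s).2 natrM natrM subr0; field; exact/andP.
    - by rewrite (F_side s).1 muln0 subrr mul0r.
    - by rewrite (F_side s).2 natrM natrM subr0; field; exact/andP.
  by move=> l l_facet; rewrite satisfies_facet_ineq holds_copula_of // F_iso.
(* A matrix violating only inequality k tells it apart from the others. *)
have ineq_inj : {in facets p q &, injective (facet_ineq R p q)}.
  move=> k l; rewrite !mem_facets => k_facet l_facet eq_kl.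
  have [x [_ x_iso]] := witness k k_facet.
  have [//|kl] := eqVneq k l.
  by have := x_iso l l_facet; rewrite -eq_kl x_iso // eqxx eq_sym kl.
rewrite udc_ineqsE; split; first by rewrite map_inj_in_uniq ?uniq_facets.
move=> _ /mapP[k + ->]; rewrite mem_facets => k_facet.
have [x [Vx x_iso]] := witness k k_facet; exists x; split=> //.
  move=> _ /mapP[l + ->]; rewrite mem_facets => l_facet.
  by rewrite x_iso //; apply: contraNneq => ->.
by rewrite x_iso // eqxx.
Qed.

(** * Tents: the corner and convexity inequalities *)

(** The Green function of the second difference on [{0, ..., n}] with zero boundary values and pole
    [k], multiplied by [n] to avoid division. *)
Definition tent (R : realFieldType) (n k i : nat) : R :=
  if (i <= k)%N then i%:R * (n%:R - k%:R) else k%:R * (n%:R - i%:R).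

Lemma tentS (R : realFieldType) (n k i : nat) :
  tent R n k i.+1 = tent R n k i + (if (i < k)%N then n%:R - k%:R else - k%:R).
Proof.
rewrite /tent; case: (ltngtP i k) => [lt_ik|lt_ki|->]; rewrite -natr1; ring.
Qed.

Lemma tent_ge0 (R : realFieldType) (n k i : nat) :
  (k <= n)%N -> (i <= n)%N -> 0 <= tent R n k i.
Proof.
by move=> kn i_n; rewrite /tent; case: ifP => _;
  rewrite mulr_ge0 ?ler0n ?subr_ge0 ?ler_nat.
Qed.

Lemma tent_bound (R : realFieldType) (n k i : nat) :
  (k <= n)%N -> (i <= n)%N -> tent R n k i <= n%:R ^+ 2.
Proof.
by move=> kn i_n; rewrite /tent; case: ifP => _; rewrite expr2 ler_pM ?ler0n
  ?subr_ge0 ?ler_nat // lerBlDr lerDl ler0n.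
Qed.

Lemma tent_second_difference (R : realFieldType) (n k i : nat) :
  tent R n k i + tent R n k i.+2 = 2 * tent R n k i.+1 - (i.+1 == k)%:R * n%:R.
Proof.
rewrite !tentS; case: (ltngtP i.+1 k) => ik /=.
- ring.
- ring.
- ring.
Qed.

Lemma tent_concave (R : realFieldType) (n k i : nat) :
  tent R n k i + tent R n k i.+2 <= 2 * tent R n k i.+1.
Proof. by rewrite tent_second_difference gerBl mulr_ge0. Qed.

Lemma tent0 (R : realFieldType) (n k : nat) : tent R n k 0 = 0.
Proof. by rewrite /tent mul0r. Qed.

Lemma tentn (R : realFieldType) (n k : nat) : (k < n)%N -> tent R n k n = 0.
Proof. by rewrite /tent ltnNge => /negPf->; rewrite subrr mulr0. Qed.

Lemma tentP (R : realFieldType) (n k : nat) : tent R n k k = k%:R * (n%:R - k%:R).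
Proof. by rewrite /tent leqnn. Qed.

Lemma tent_ge1 (R : realFieldType) (n k i : nat) :
  (0 < k < n)%N -> (0 < i < n)%N -> 1 <= tent R n k i.
Proof.
move=> /andP[k0 kn] /andP[i0 i_n]; rewrite /tent.
by case: ifP => _; rewrite -natrB ?(ltnW kn) ?(ltnW i_n) // -natrM ler1n muln_gt0; lia.
Qed.

(** The factor makes the value at the isolated corner 2. Both tents have slope 1 or -1 away from
    their steep end, so the opposite corner value and the mixed differences of inner cells have
    absolute value [e], which is at most 1/2 since [p, q >= 3]. *)
Lemma isolates_corner (R : realFieldType) (p q k l : nat) (c : facet) :
  (3 <= p)%N -> (3 <= q)%N ->
  (k, l, c) \in [:: (1, 1, LowerCorner); (p.-1, q.-1, UpperCorner)]%N ->
  isolates R p q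
    (fun i j => 2 / ((p%:R - 1) * (q%:R - 1)) * (tent R p k i * tent R q l j)) c.
Proof.
move=> p3 q3 klc.
have p3R : 3 <= p%:R :> R by rewrite ler_nat.
have q3R : 3 <= q%:R :> R by rewrite ler_nat.
set e := 2 / _.
have eE : e * ((p%:R - 1) * (q%:R - 1)) = 2.
  by rewrite /e; field; apply/andP; split; lra.
have e_le : e <= 1 / 2.
  by rewrite ler_pdivrMr; [nra|rewrite mulr_gt0; lra].
have e_ge0 : 0 <= e by rewrite divr_ge0 ?mulr_ge0; lra.
have [kp lq] : (0 < k < p)%N /\ (0 < l < q)%N.
  by move: klc; rewrite !inE => /orP[] /eqP[-> -> _]; lia.
have predE n : (3 <= n)%N -> n.-1%:R = n%:R - 1 :> R.
  by case: n => // n _; rewrite -[n.+1%:R]natr1 addrK.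
have [/andP[_ kp1] /andP[_ lq1]] := (kp, lq).
have far n : (3 <= n)%N -> tent R n 1 n.-1 = 1 /\ tent R n n.-1 1 = 1.
  case: n => [|[|[|n]]] // _; rewrite /tent /= -[n.+3%:R]natr1.
  by split; ring.
have peak n : (3 <= n)%N -> tent R n 1 1 = n%:R - 1 /\ tent R n n.-1 n.-1 = n%:R - 1.
  by move=> n3; rewrite !tentP predE //; split; ring.
have [[pk1 pk2] [qk1 qk2]] := (peak p p3, peak q q3).
have [[pf1 pf2] [qf1 qf2]] := (far p p3, far q q3).
have big : (e * ((p%:R - 1) * (q%:R - 1)) <= 1) = false.
  by apply/negbTE; rewrite eE -ltNge; lra.
have small : e * (1 * 1) <= 1 by lra.
split=> [j|i|].
- by rewrite tent0 tentn ?mul0r ?mulr0.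
- by rewrite tent0 tentn ?mulr0.
case=> [||i j|i j|i j] /=.
- move=> _; move: klc; rewrite !inE => /orP[] /eqP[-> -> ->].
    by rewrite pk1 qk1 big.
  by rewrite pf2 qf2 small.
- move=> _; move: klc; rewrite !inE => /orP[] /eqP[-> -> ->].
    by rewrite pf1 qf1 small.
  by rewrite pk2 qk2 big.
- case/and5P => i0 ip j0 jq _.
  have -> : Rectangle i j != c by move: klc; rewrite !inE => /orP[] /eqP[_ _ ->].
  rewrite !tentS; move: klc; rewrite !inE => /orP[] /eqP[-> -> _].
    rewrite !ltnS !leqn0 (gtn_eqF i0) (gtn_eqF j0); lra.
  rewrite !ltn_predRL ip jq !predE //; lra.
- case/and3P => i0 ip jq.
  have -> : RowConvexity i j != c by move: klc; rewrite !inE => /orP[] /eqP[_ _ ->].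
  rewrite -mulrDr -mulrDr (mulrCA 2) ler_wpM2l // (mulrCA 2) ler_wpM2l ?tent_concave //.
  by rewrite tent_ge0 // ltnW.
- case/and3P => j0 jq ip.
  have -> : ColConvexity i j != c by move: klc; rewrite !inE => /orP[] /eqP[_ _ ->].
  rewrite -mulrDr -mulrDl (mulrCA 2) ler_wpM2l // mulrA ler_wpM2r ?tent_concave //.
  by rewrite tent_ge0 // ltnW.
Qed.

Lemma isolates_RowConvexity (R : realFieldType) (p q i0 j0 : nat) :
  (3 <= q)%N -> is_facet p q (RowConvexity i0 j0) ->
  exists F, isolates R p q F (RowConvexity i0 j0).
Proof.
move=> q3 /and3P[i0_gt0 i0p j0q].
(* The inequality is centred at column [j0.+1]; since [q >= 3], there is another inner column where
   the tent can peak. *)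
have [l [lq l_gt0 lj]] : exists l, [/\ (l < q)%N, (0 < l)%N & l != j0.+1].
  by exists (if j0 == 0 then 2 else 1)%N; case: eqP; split; lia.
pose d i j : R := ((i == i0) && (j == j0.+1))%:R.
(* Corner values and mixed differences of [T - d] are at most [2 p^2 q^2 + 2], hence at most
   [4 p^2 q^2 = 1 / e]. *)
pose e : R := ((2 * p * q) ^ 2)%:R^-1.
have e_gt0 : 0 < e by rewrite invr_gt0 ltr0n expn_gt0 !muln_gt0; lia.
have p1 : 1 <= p%:R :> R by rewrite ler1n; lia.
have q1 : 1 <= q%:R :> R by rewrite ler1n; lia.
pose T i j : R := tent R p i0 i * tent R q l j.
have T_ge0 i j : (i <= p)%N -> (j <= q)%N -> 0 <= T i j.
  by move=> ip jq; rewrite mulr_ge0 ?tent_ge0 // ltnW.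
have T_le i j : (i <= p)%N -> (j <= q)%N -> T i j <= p%:R ^+ 2 * q%:R ^+ 2.
  by move=> ip jq; rewrite ler_pM ?tent_ge0 ?tent_bound // ltnW.
have eE : e * (4 * (p%:R ^+ 2 * q%:R ^+ 2)) = 1.
  rewrite /e natrX !natrM; field; apply/andP; split; lra.
have d_ge0 i j : 0 <= d i j by rewrite ler0n.
have d_le1 i j : d i j <= 1 by rewrite lern1 leq_b1.
have PQ : 1 <= p%:R ^+ 2 * q%:R ^+ 2 :> R by rewrite mulr_ege1 // expr_ge1 //; lra.
have le1 u : u <= 4 * (p%:R ^+ 2 * q%:R ^+ 2) -> e * u <= 1.
  by move=> u_le; rewrite -[leRHS]eE ler_pM2l.
exists (fun i j => e * (T i j - d i j)); split=> [j|i|].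
- rewrite /T /d tent0 tentn // !mul0r (gtn_eqF i0p).
  by rewrite eq_sym (gtn_eqF i0_gt0) subrr mulr0.
- rewrite /T /d tent0 tentn // !mulr0 (gtn_eqF j0q).
  by rewrite !andbF subrr mulr0.
case=> [||i j|i j|i j] /=.
- move=> _; apply: le1; have := T_le 1%N 1%N ltac:(lia) ltac:(lia).
  have := d_ge0 1%N 1%N; lra.
- move=> _; apply: le1; have := T_le p.-1 q.-1 (leq_pred p) (leq_pred q).
  have := d_ge0 p.-1 q.-1; lra.
- case/and5P => i_gt0 ip j_gt0 jq _; rewrite -mulrDr -!mulrBr; apply: le1.
  have := T_le i j ltac:(lia) ltac:(lia); have := T_le i.+1 j.+1 ltac:(lia) ltac:(lia).
  have := T_ge0 i.+1 j ltac:(lia) ltac:(lia); have := T_ge0 i j.+1 ltac:(lia) ltac:(lia).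
  have := (d_ge0 i j, d_ge0 i.+1 j.+1, d_le1 i j.+1, d_le1 i.+1 j) => -[[[]]].
  lra.
- case/and3P => i_gt0 ip jq.
  rewrite -mulrDr (mulrCA 2) ler_pM2l //.
  have [[-> ->]|neq] := eqVneq (RowConvexity i j) (RowConvexity i0 j0).
    have := tent_second_difference R q l j0; rewrite eq_sym (negPf lj) mul0r subr0.
    rewrite /d /T !eqxx (ltn_eqF (ltnSn j0)) (gtn_eqF (ltnSn j0.+1)) /= => e2.
    apply/negbTE; rewrite -ltNge.
    have -> : tent R q l j0 = 2 * tent R q l j0.+1 - tent R q l j0.+2 by rewrite -e2; ring.
    lra.
  have d0 : d i j.+1 = 0.
    by rewrite /d eqSS; case: andP neq => // -[/eqP-> /eqP->]; rewrite eqxx.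
  have T2 : T i j + T i j.+2 <= 2 * T i j.+1.
    rewrite /T -mulrDr (mulrCA 2) ler_wpM2l ?tent_concave //.
    by rewrite tent_ge0 // ltnW.
  have := (d_ge0 i j, d_ge0 i j.+2) => -[]; lra.
- case/and3P => j_gt0 jq ip.
  rewrite -mulrDr (mulrCA 2) ler_pM2l //.
  have p2 : 2 <= p%:R :> R by rewrite ler_nat; lia.
  (* When [i.+1 = i0], the bend of the tent contributes [p * tent R q l j >= 2], which pays for the
     dent [d]. *)
  have T2 : T i j + T i.+2 j <= 2 * T i.+1 j - 2 * d i.+1 j.
    rewrite /T -mulrDl tent_second_difference /d.
    have t1 : 1 <= tent R q l j by rewrite tent_ge1 ?l_gt0 ?j_gt0.
    case: (i.+1 == i0) => /=; last lra.
    have : 2 * 1 <= p%:R * tent R q l j by apply: ler_pM => //; lra.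
    by case: (j == _) => /=; lra.
  have := (d_ge0 i j, d_ge0 i.+2 j) => -[]; lra.
Qed.

(** * Transposition symmetry, reducing column convexity to row convexity *)

Definition facet_tr (k : facet) : facet :=
  match k with
  | LowerCorner => LowerCorner
  | UpperCorner => UpperCorner
  | Rectangle i j => Rectangle j i
  | RowConvexity i j => ColConvexity j i
  | ColConvexity i j => RowConvexity j i
  end.

Lemma facet_trK : involutive facet_tr. Proof. by case. Qed.

Lemma is_facet_tr (p q : nat) (k : facet) :
  is_facet q p (facet_tr k) = is_facet p q k.
Proof. by case: k => //= i j; rewrite !inE !xpair_eqE; lia. Qed.

Lemma isolates_tr (R : realFieldType) (p q : nat) (F : nat -> nat -> R) (k : facet) :
  isolates R p q F k -> isolates R q p (fun i j => F j i) (facet_tr k).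
Proof.
case=> F_top F_side F_iso; split=> // l; rewrite -is_facet_tr => /F_iso.
rewrite -(inj_eq (inv_inj facet_trK)) facet_trK => <-.
by case: l => //= i j; congr (_ <= _); ring.
Qed.

(** * Piecewise bilinear functions: the cell inequalities *)

(* Piecewise linear on {0, ..., k+1+c}, with value u at k, v at k+1 and 0 at both ends. *)
Definition hat (R : realFieldType) (k c : nat) (u v : R) (i : nat) : R :=
  if (i <= k)%N then i%:R / k%:R * u else ((k.+1 + c)%:R - i%:R) / c%:R * v.

Lemma hatS (R : realFieldType) (k c : nat) (u v : R) (i : nat) :
  (0 < k)%N -> (0 < c)%N ->
  hat R k c u v i.+1 =
  hat R k c u v i + (if (i < k)%N then u / k%:R else if i == k then v - u else - (v / c%:R)).
Proof.
move=> k0 c0; have kn0 : k%:R != 0 :> R by rewrite pnatr_eq0 -lt0n.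
have cn0 : c%:R != 0 :> R by rewrite pnatr_eq0 -lt0n.
by rewrite /hat natrD; case: (ltngtP i k) => [ik|ki|->]; rewrite -!natr1; field; rewrite ?kn0 ?cn0.
Qed.

(** The successive slopes are [u / k], [v - u] and [- v / c]; the two hypotheses on [u] and [v] say
    that they decrease. *)
Lemma hat_concave (R : realFieldType) (k c : nat) (u v : R) (i : nat) :
  (0 < k)%N -> (0 < c)%N -> k%:R * v <= k.+1%:R * u -> c%:R * u <= c.+1%:R * v ->
  hat R k c u v i + hat R k c u v i.+2 <= 2 * hat R k c u v i.+1.
Proof.
move=> k0 c0; rewrite -!natr1 => le_v le_u.
have kp : 0 < k%:R :> R by rewrite ltr0n.
have cp : 0 < c%:R :> R by rewrite ltr0n.
have vu : v - u <= u / k%:R by rewrite ler_pdivlMr //; lra.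
have uv : - (v / c%:R) <= v - u by rewrite lerNl opprB ler_pdivlMr //; lra.
rewrite !hatS //; case: (ltngtP i.+1 k) => ik.
- lra.
- case: (ltngtP i k) => [?|?|->]; [lia | lra | lra].
- lra.
Qed.

Lemma hat0 (R : realFieldType) (k c : nat) (u v : R) : hat R k c u v 0 = 0.
Proof. by rewrite /hat mul0r mul0r. Qed.

Lemma hatn (R : realFieldType) (k c : nat) (u v : R) : hat R k c u v (k.+1 + c) = 0.
Proof. by rewrite /hat leqNgt ltn_addr // subrr mul0r mul0r. Qed.

Lemma hat1 (R : realFieldType) (k c : nat) (u v : R) : (0 < k)%N -> hat R k c u v 1 = u / k%:R.
Proof. by move=> k0; rewrite /hat k0 mul1r mulrC. Qed.

Lemma hat_pred (R : realFieldType) (k c : nat) (u v : R) : (0 < c)%N ->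
  hat R k c u v (k.+1 + c).-1 = v / c%:R.
Proof.
case: c => // c _; rewrite addnS /= /hat leqNgt ltn_addr //= addnS.
by rewrite -[(k.+1 + c).+1%:R]natr1 addrAC subrr add0r mul1r mulrC.
Qed.

(** A hat is linear and monotone in its two vertex values, so concavity across grid lines need only
    be checked at the vertices. *)
Lemma hat_linear_le (R : realFieldType) (k c : nat) (s t u v u' v' : R) (i : nat) :
  s * u <= t * u' -> s * v <= t * v' -> (i <= k.+1 + c)%N ->
  s * hat R k c u v i <= t * hat R k c u' v' i.
Proof.
move=> le_u le_v i_le; rewrite /hat.
by case: ifP => _; rewrite (mulrCA s) (mulrCA t) ler_wpM2l // divr_ge0 ?subr_ge0 ?ler_nat.
Qed.

(** The lines through the vertices cut the grid into nine blocks with constant mixed difference. On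
    the two corner blocks it is [A / (a b)] and [D / (c d)], also the values at the two corners. On
    a side block concavity bounds it by that of an adjacent one of these two blocks. On the
    remaining two corner blocks it is nonpositive, and on the middle cell it exceeds 1. *)
Lemma isolates_hat (R : realFieldType) (a b c d : nat) (A D x y : R) :
  (0 < a)%N -> (0 < b)%N -> (0 < c)%N -> (0 < d)%N ->
  0 <= A -> 0 <= D -> 0 <= x -> 0 <= y ->
  b%:R * x <= b.+1%:R * A -> d%:R * A <= d.+1%:R * x ->
  b%:R * D <= b.+1%:R * y -> d%:R * y <= d.+1%:R * D ->
  a%:R * y <= a.+1%:R * A -> c%:R * A <= c.+1%:R * y ->
  a%:R * D <= a.+1%:R * x -> c%:R * x <= c.+1%:R * D ->
  A <= a%:R * b%:R -> D <= c%:R * d%:R -> 1 < A + D - x - y ->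
  isolates R (a.+1 + c) (b.+1 + d)
    (fun i j => hat R a c (hat R b d A x j) (hat R b d y D j) i) (Rectangle a b).
Proof.
move=> a0 b0 c0 d0 A0 D0 x0 y0 bx dA bD dy ay cA aD cx lA lD big.
have [ap bp cp dp] : [/\ 0 < a%:R :> R, 0 < b%:R :> R, 0 < c%:R :> R & 0 < d%:R :> R].
  by rewrite !ltr0n.
split=> [j|i|].
- by rewrite hat0 hatn.
- by rewrite !hat0 !hatn /hat !mulr0 if_same.
have lA' : A / b%:R / a%:R <= 1 by rewrite !ler_pdivrMr // mul1r.
have lD' : D / d%:R / c%:R <= 1 by rewrite !ler_pdivrMr // mul1r.
case=> [||i j|i j|i j].
- by move=> _; rewrite /= !hat1.
- by move=> _; rewrite /= !hat_pred.
- case/and5P => i_gt0 ip j_gt0 jq _.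
  have -> : (Rectangle i j != Rectangle a b) = ~~ ((i == a) && (j == b)) by [].
  have slope u v n m : 0 < n -> n * u <= (n + 1) * v -> v / n / m <= 1 -> 0 < m ->
      (u - v) / m <= 1 :> R.
    move=> n0 le_uv le1 m0; apply: le_trans le1; rewrite ler_wpM2r ?invr_ge0 ?(ltW m0) //.
    by rewrite ler_pdivlMr //; lra.
  have nonneg u n m : 0 <= u -> 0 < n -> 0 < m -> 0 <= u / n / m :> R.
    by move=> u0 n0 m0; rewrite !divr_ge0 // ltW.
  have lA'' : A / a%:R / b%:R <= 1 by rewrite mulrAC.
  have lD'' : D / c%:R / d%:R <= 1 by rewrite mulrAC.
  move: bx ay dy cx; rewrite -!natr1 => bx ay dy cx.
  have f12 := slope x A b%:R a%:R bp bx lA' ap.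
  have f21 := slope y A a%:R b%:R ap ay lA'' bp.
  have f23 := slope x D c%:R d%:R cp cx lD'' dp.
  have f32 := slope y D d%:R c%:R dp dy lD' cp.
  have f13 := nonneg x d%:R a%:R x0 dp ap.
  have f31 := nonneg y b%:R c%:R y0 bp cp.
  rewrite /= !(hatS R a c) // !(hatS R b d) //.
  case: (ltngtP i a) => _; case: (ltngtP j b) => _ /=; lra.
- case/and3P => i_gt0 ip jq; rewrite /= /hat.
  have row1 := hat_concave R b d A x j b0 d0 bx dA.
  have row2 := hat_concave R b d y D j b0 d0 bD dy.
  case: ifP => _; rewrite -mulrDr (mulrCA 2) ler_wpM2l // divr_ge0 //.
  by rewrite subr_ge0 ler_nat ltnW.
- case/and3P => j_gt0 jq ip; rewrite /=.
  by apply: hat_concave => //; apply: hat_linear_le => //; rewrite ltnW.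
Qed.

Lemma isolates_Rectangle (R : realFieldType) (p q a b : nat) :
  is_facet p q (Rectangle a b) -> exists F, isolates R p q F (Rectangle a b).
Proof.
case/and5P=> a0 ap b0 bq; rewrite !inE !xpair_eqE => cell.
have [c [c0 pE]] : exists c, (0 < c)%N /\ p = (a.+1 + c)%N.
  by exists (p - a.+1)%N; lia.
have [d [d0 qE]] : exists d, (0 < d)%N /\ q = (b.+1 + d)%N.
  by exists (q - b.+1)%N; lia.
(* [a * b = 1] or [c * d = 1] would make the cell one of the two omitted ones. *)
have ab1 : (1 < a * b)%N by nia.
have cd1 : (1 < c * d)%N by nia.
have [A [D [x [y]]]] := cell_values_exist a b c d a0 b0 c0 d0 ab1 cd1.
case=> [[bx dA bD dy] [[ay cA aD cx] [A0 D0 lA lD]]].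
(* Dividing by [m] makes the larger of the two corner block differences equal to 1, so that the
   strictly larger one on the cell exceeds 1. *)
pose m : R := Num.max (A%:R / (a%:R * b%:R)) (D%:R / (c%:R * d%:R)).
have ab_gt0 : 0 < a%:R * b%:R :> R by rewrite mulr_gt0 ?ltr0n.
have cd_gt0 : 0 < c%:R * d%:R :> R by rewrite mulr_gt0 ?ltr0n.
have m_gt0 : 0 < m by rewrite lt_max divr_gt0 ?ltr0n.
pose s := m^-1; have s_gt0 : 0 < s by rewrite invr_gt0.
have scaled n k u v : (n * u <= k * v)%N -> n%:R * (s * u%:R) <= k%:R * (s * v%:R) :> R.
  by move=> le_uv; rewrite !(mulrCA _ s) ler_pM2l // -!natrM ler_nat.
have s_ge0 u : 0 <= s * u%:R by rewrite mulr_ge0 ?ler0n // ltW.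
rewrite pE qE; eexists; apply: (isolates_hat R a b c d (s * A%:R) (s * D%:R)
  (s * x%:R) (s * y%:R)) => //; try exact: scaled.
- by rewrite mulrC ler_pdivrMr // mulrC -ler_pdivrMr // le_max lexx.
- by rewrite mulrC ler_pdivrMr // mulrC -ler_pdivrMr // le_max lexx orbT.
rewrite -mulrDr -!mulrBr mulrC ltr_pdivlMr // mul1r gt_max !ltr_pdivrMr //.
move: lA lD; rewrite -!(ltr_nat R) !natrD !natrM !natrD => lA lD.
by apply/andP; split; lra.
Qed.

(** * Witnesses for all inequalities, and the conclusion *)

Lemma isolates_exist (R : realFieldType) (p q : nat) (k : facet) :
  (3 <= p)%N -> (3 <= q)%N -> is_facet p q k -> exists F, isolates R p q F k.
Proof.
move=> p3 q3; case: k => [||i j|i j|i j] k_facet.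
- by eexists; apply: (isolates_corner R p q 1 1) => //; rewrite inE eqxx.
- by eexists; apply: (isolates_corner R p q p.-1 q.-1) => //; rewrite !inE eqxx orbT.
- exact: isolates_Rectangle.
- exact: isolates_RowConvexity.
- have [|F /isolates_tr] := isolates_RowConvexity R q p j i p3; last by exists (fun i j => F j i).
  by rewrite -is_facet_tr.
Qed.

Theorem theorem1 (R : realFieldType) (p q : nat)
    (p_gt0 : (0 < p)%N) (q_gt0 : (0 < q)%N) :
  H_representation (@copula_boundary R p q)
    (@ultramodular_discrete_copula R p q) (udc_ineqs R p q) /\
  ((3 <= p)%N -> (3 <= q)%N ->
     minimal_H_representation (@copula_boundary R p q)
       (@ultramodular_discrete_copula R p q) (udc_ineqs R p q) /\
     ((p, q) <> (3, 3)%N ->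
        size (udc_ineqs R p q) =
          ((p - 2) * (q - 2) + 2 * ((p - 1) * (q - 1)))%N)).
Proof.
have rep := H_representation_udc R p q p_gt0 q_gt0; split=> // p3 q3.
split; last exact: size_udc_ineqs.
split=> //; apply: irredundant_of_isolates; [exact: ltnW|exact: ltnW|].
by move=> k; apply: isolates_exist.
Qed.
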